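(* A matroid $M$ is $M(\mathcal{W}_2)$-connected if and only if $M$ is connected and non-uniform.
   Context: A matroid $M$ with $|E(M)| \geq 2$ is $N$-connected if for every pair of distinct elements $e,f \in E(M)$ there is a minor of $M$ isomorphic to $N$ whose ground set contains $\{e,f\}$. $M(\mathcal{W}_2)$ is the cycle matroid of the rank-2 wheel, i.e. the rank-2 matroid on four elements $\{a,b,c,d\}$ whose circuits are $\{a,b\}$, $\{a,c,d\}$, $\{b,c,d\}$. *)

(* Defs.v *)
From mathcomp Require Import all_boot.
Set Implicit Arguments.
Unset Strict Implicit.
Unset Printing Implicit Defensive.

(* Finite matroids, given by independent sets. The ground set is a finite set
   of points of T rather than all of T, so that minors of a matroid over T are
   again matroids over T. *)
Definition matroid_axiom (T : finType) (E : {set T}) (F : {set {set T}}) : bool :=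
  [&& [forall I in F, I \subset E],
      set0 \in F,
      [forall I in F, forall J : {set T}, (J \subset I) ==> (J \in F)] &
      [forall I in F, forall J in F, (#|I| < #|J|) ==>
         [exists x in J :\: I, x |: I \in F]]].

Record matroid (T : finType) := Matroid {
  ground : {set T};
  indep : {set {set T}};
  matroidP : matroid_axiom ground indep }.

Lemma matroid_axiomP (T : finType) (E : {set T}) (F : {set {set T}}) :
  reflect [/\ forall I : {set T}, I \in F -> I \subset E,
              set0 \in F,
              forall I J : {set T}, I \in F -> J \subset I -> J \in F &
              forall I J : {set T}, I \in F -> J \in F -> #|I| < #|J| ->
                exists2 x, x \in J :\: I & x |: I \in F]
          (matroid_axiom E F).
Proof.
apply: (iffP and4P) => -[H1 H2 H3 H4]; split=> //.
- by move=> I IF; apply: (forall_inP H1).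
- move=> I J IF JI; exact: (implyP (forallP (forall_inP H3 I IF) J) JI).
- move=> I J IF JF lt_IJ.
  have := implyP (forall_inP (forall_inP H4 I IF) J JF) lt_IJ.
  by case/exists_inP=> x; exists x.
- exact/forall_inP.
- apply/forall_inP=> I IF; apply/forallP=> J; apply/implyP; exact: H3.
- apply/forall_inP=> I IF; apply/forall_inP=> J JF; apply/implyP=> lt_IJ.
  by apply/exists_inP; have [x] := H4 I J IF JF lt_IJ; exists x.
Qed.

Definition basis (T : finType) (M : matroid T) (B : {set T}) : bool :=
  maxset (fun I : {set T} => I \in indep M) B.

Definition circuit (T : finType) (M : matroid T) (C : {set T}) : bool :=
  minset (fun X : {set T} => (X \subset ground M) && (X \notin indep M)) C.

(* The bases of the dual are the complements in E(M) of the bases of M. *)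
Definition dual_indep (T : finType) (M : matroid T) : {set {set T}} :=
  [set I : {set T} | [exists B, basis M B && (I \subset ground M :\: B)]].

Lemma augment_to (T : finType) (M : matroid T) (I B : {set T}) :
  I \in indep M -> B \in indep M ->
  exists J, [/\ J \in indep M, I \subset J, J \subset I :|: B & #|B| <= #|J|].
Proof.
have [_ _ _ Maug] := matroid_axiomP _ _ (matroidP M).
move=> + BM; have [n] := ubnP (#|B| - #|I|).
elim: n I => // n IHn I /ltnSE le_n IM.
have [le_BI|lt_IB] := leqP #|B| #|I|; first by exists I; split; rewrite ?subsetUl.
have [x /setDP[xB xI] xIM] := Maug I B IM BM lt_IB.
have [|J [JM xIJ JxIB le_BJ]] := IHn (x |: I) _ xIM.
  apply: leq_trans le_n; rewrite cardsU1 xI.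
  by rewrite ltn_sub2l // add1n ltnSn.
exists J; split=> //; first exact: subset_trans (subsetUr _ _) xIJ.
apply: subset_trans JxIB _; rewrite -setUA subUset subxx andbT sub1set.
by rewrite inE xB orbT.
Qed.

Lemma basis_max (T : finType) (M : matroid T) (I B : {set T}) :
  basis M B -> I \in indep M -> #|I| <= #|B|.
Proof.
case/maxsetP=> BM Bmax IM.
have [J [JM BJ _ le_IJ]] := augment_to BM IM.
by rewrite -(Bmax J JM BJ).
Qed.

Lemma dual_matroid_axiom (T : finType) (M : matroid T) :
  matroid_axiom (ground M) (dual_indep M).
Proof.
have [Msub M0 Mdn Maug] := matroid_axiomP _ _ (matroidP M).
have dualP (I : {set T}) : reflect (exists2 B, basis M B & I \subset ground M :\: B)
                       (I \in dual_indep M).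
  by rewrite inE; apply: (iffP exists_inP).
apply/matroid_axiomP; split.
- by move=> I /dualP[B _ IB]; apply: subset_trans IB (subsetDl _ _).
- have [B maxB _] := maxset_exists (P := fun I : {set T} => I \in indep M) M0.
  by apply/dualP; exists B => //; apply: sub0set.
- move=> I J /dualP[B bB IB] JI; apply/dualP; exists B => //.
  exact: subset_trans JI IB.
- move=> I J /dualP[B' bB' IB'] /dualP[B bB JB] lt_IJ.
  have [B'M _] := maxsetP bB'; have [BM _] := maxsetP bB.
  have BIM : B :\: I \in indep M by apply: Mdn BM _; apply: subsetDl.
  have [B1 [B1M BIB1 B1sub le_B1]] := augment_to BIM B'M.
  have bB1 : basis M B1.
    apply/maxsetP; split=> // C CM B1C; apply/eqP; rewrite eq_sym eqEcard B1C.
    exact: leq_trans (basis_max bB' CM) le_B1.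
  have IE : I \subset ground M by apply: subset_trans IB' (subsetDl _ _).
  have JE : J \subset ground M by apply: subset_trans JB (subsetDl _ _).
  have IB1 : [disjoint I & B1].
    apply/pred0P=> x /=; apply/negP=> /andP[xI] /(subsetP B1sub).
    rewrite !inE xI /= => xB'.
    by have := subsetP IB' x xI; rewrite inE xB'.
  have JdB : [disjoint J & B].
    apply/pred0P=> x /=; apply/negP=> /andP[/(subsetP JB)].
    by rewrite inE => /andP[/negP].
  have [JIB1|] := boolP (J :\: I \subset B1).
    have lt1 : #|I :\: J| < #|J :\: I|.
      by move: lt_IJ; rewrite -(cardsID J I) -(cardsID I J) setIC ltn_add2l.
    have lt2 : #|B :&: I| <= #|I :\: J|.
      apply/subset_leq_card/subsetP=> x; rewrite !inE => /andP[xB ->].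
      by rewrite andbT; apply/negP=> xJ; have := pred0P JdB x; rewrite /= xJ xB.
    have : #|(B :\: I) :|: (J :\: I)| <= #|B|.
      apply: leq_trans (basis_max bB B1M); apply: subset_leq_card.
      by rewrite subUset BIB1.
    rewrite cardsU (_ : _ :&: _ = set0) ?cards0 ?subn0; last first.
      apply/setP=> x; rewrite !inE; have := pred0P JdB x; rewrite /=.
      by case: (x \in J); case: (x \in B); rewrite ?andbF.
    rewrite -[X in _ <= X](cardsID I B) addnC leq_add2r => le3.
    by have := leq_trans lt1 (leq_trans le3 lt2); rewrite ltnn.
  case/subsetPn=> x xJI xB1; exists x => //; apply/dualP; exists B1 => //.
  move: xJI => /setDP[xJ _].
  rewrite subUset sub1set !inE xB1 (subsetP JE) //=.
  by rewrite subsetD IE.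
Qed.

Definition dual (T : finType) (M : matroid T) : matroid T :=
  Matroid (dual_matroid_axiom M).

Lemma basis_dual (T : finType) (M : matroid T) (B : {set T}) :
  basis (dual M) B = (B \subset ground M) && basis M (ground M :\: B).
Proof.
have [Msub _ _ _] := matroid_axiomP _ _ (matroidP M).
have dualP (I : {set T}) : reflect (exists2 B, basis M B & I \subset ground M :\: B)
                                   (I \in indep (dual M)).
  by rewrite inE; apply: (iffP exists_inP).
have bE A : basis M A -> A \subset ground M by case/maxsetP=> /Msub.
apply/idP/andP=> [/maxsetP[/dualP[A bA BA] Bmax]|[BE bB]].
  have EA : ground M :\: A \in indep (dual M) by apply/dualP; exists A.
  rewrite -(Bmax _ EA BA) subsetDl; split=> //.
  by rewrite setDDr setDv set0U (setIidPr (bE _ bA)).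
apply/maxsetP; split=> [|I /dualP[A bA IA] BI].
  by apply/dualP; exists (ground M :\: B); rewrite // setDDr setDv set0U (setIidPr BE).
apply/eqP; rewrite eq_sym eqEcard BI.
apply: leq_trans (subset_leq_card IA) _.
rewrite cardsD (setIidPr (bE _ bA)) leq_subCl.
have := basis_max bB (proj1 (maxsetP bA)); have := basis_max bA (proj1 (maxsetP bB)).
by rewrite [#|_ :\: B|]cardsD (setIidPr BE).
Qed.

Lemma delete_matroid_axiom (T : finType) (M : matroid T) (D : {set T}) :
  matroid_axiom (ground M :\: D)
    [set I in indep M | I \subset ground M :\: D].
Proof.
have [Msub M0 Mdn Maug] := matroid_axiomP _ _ (matroidP M).
apply/matroid_axiomP; split.
- by move=> I; rewrite inE => /andP[].
- by rewrite inE M0 sub0set.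
- move=> I J; rewrite !inE => /andP[IM IE] JI.
  by rewrite (Mdn I) // (subset_trans JI).
- move=> I J; rewrite !inE => /andP[IM IE] /andP[JM JE] lt_IJ.
  have [x xJI xIM] := Maug I J IM JM lt_IJ; exists x => //.
  rewrite inE xIM subUset IE andbT sub1set (subsetP JE) //.
  by case/setDP: xJI.
Qed.

Definition delete (T : finType) (M : matroid T) (D : {set T}) : matroid T :=
  Matroid (delete_matroid_axiom M D).

Definition contract (T : finType) (M : matroid T) (C : {set T}) : matroid T :=
  dual (delete (dual M) C).

Definition minor (T : finType) (N M : matroid T) : Prop :=
  exists C D : {set T},
    [/\ C \subset ground M, D \subset ground M, [disjoint C & D] &
        N = delete (contract M C) D].

(* A bijection from E(M) onto E(N) preserving independence both ways; its
   domain is the subtype of points of E(M), so the points of T outside E(M)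
   play no role. *)
Definition isomorphic (T U : finType) (M : matroid T) (N : matroid U) : Prop :=
  exists f : {x : T | x \in ground M} -> U,
    [/\ injective f,
        f @: [set: {x : T | x \in ground M}] = ground N &
        forall X : {set {x : T | x \in ground M}},
          (val @: X \in indep M) = (f @: X \in indep N)].

Definition N_connected (T U : finType) (N : matroid U) (M : matroid T) : Prop :=
  2 <= #|ground M| /\
  forall e f : T, e \in ground M -> f \in ground M -> e != f ->
    exists M' : matroid T,
      [/\ minor M' M, isomorphic M' N & [set e; f] \subset ground M'].

Definition matroid_connected (T : finType) (M : matroid T) : Prop :=
  forall e f : T, e \in ground M -> f \in ground M -> e != f ->
    exists2 C, circuit M C & [set e; f] \subset C.

Definition uniform (T : finType) (M : matroid T) : Prop :=
  exists2 r, r <= #|ground M| &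
    indep M = [set I : {set T} | (I \subset ground M) && (#|I| <= r)].

(* M(W_2): a and b are the rim edges, c and d the spokes. *)
Definition W2a : 'I_4 := @Ordinal 4 0 isT.
Definition W2b : 'I_4 := @Ordinal 4 1 isT.
Definition W2c : 'I_4 := @Ordinal 4 2 isT.
Definition W2d : 'I_4 := @Ordinal 4 3 isT.

Definition W2_circuits : {set {set 'I_4}} :=
  [set [set W2a; W2b]; [set W2a; W2c; W2d]; [set W2b; W2c; W2d]].

Definition W2_indep : {set {set 'I_4}} :=
  [set I : {set 'I_4} | [forall C in W2_circuits, ~~ (C \subset I)]].

Lemma W2_indepE (I : {set 'I_4}) :
  (I \in W2_indep) =
    ~~ [|| (W2a \in I) && (W2b \in I),
           [&& W2a \in I, W2c \in I & W2d \in I]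
         | [&& W2b \in I, W2c \in I & W2d \in I]].
Proof.
rewrite inE; apply/forall_inP/idP => [H|].
  have := (H [set W2a; W2b], H [set W2a; W2c; W2d], H [set W2b; W2c; W2d]).
  rewrite !inE !eqxx !orbT => -[[/(_ isT) + /(_ isT) +] /(_ isT)].
  by rewrite !subUset !sub1set !negb_or -!andbA => -> -> ->.
rewrite !negb_or => /and3P[H1 H2 H3] C.
by rewrite !inE -orbA => /or3P[] /eqP->; rewrite !subUset !sub1set -?andbA.
Qed.

Lemma card_set_I4 (I : {set 'I_4}) :
  #|I| = (W2a \in I) + (W2b \in I) + (W2c \in I) + (W2d \in I).
Proof.
rewrite -sum1_card big_mkcond !big_ord_recl big_ord0 /= addn0 !addnA.
have E i j : i = j :> 'I_4 -> (if i \in I then 1 else 0) = (j \in I).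
  by move->; case: (j \in I).
by congr (_ + _ + _ + _); apply: E; apply: val_inj.
Qed.

Lemma W2_matroid_axiom : matroid_axiom [set: 'I_4] W2_indep.
Proof.
apply/matroid_axiomP; split.
- by move=> I _; apply: subsetT.
- by rewrite W2_indepE !inE.
- move=> I J; rewrite !inE => /forall_inP IW JI; apply/forall_inP=> C CW.
  by apply: contra (IW C CW) => CJ; apply: subset_trans JI.
- move=> I J; rewrite !W2_indepE !card_set_I4 => HI HJ lt_IJ.
  suff [x [xJ xI Hx]] : exists x, [/\ x \in J, x \notin I & x |: I \in W2_indep].
    by exists x => //; rewrite inE xI xJ.
  move: HI HJ lt_IJ.
  case aI: (W2a \in I); case bI: (W2b \in I); case cI: (W2c \in I);
  case dI: (W2d \in I) => //= _;
  case aJ: (W2a \in J); case bJ: (W2b \in J); case cJ: (W2c \in J);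
  case dJ: (W2d \in J) => //= _ _;
  solve [ by exists W2a; split; rewrite ?W2_indepE ?inE ?aI ?bI ?cI ?dI
        | by exists W2b; split; rewrite ?W2_indepE ?inE ?aI ?bI ?cI ?dI
        | by exists W2c; split; rewrite ?W2_indepE ?inE ?aI ?bI ?cI ?dI
        | by exists W2d; split; rewrite ?W2_indepE ?inE ?aI ?bI ?cI ?dI ].
Qed.

Definition MW2 : matroid 'I_4 := Matroid W2_matroid_axiom.

Lemma circuit_MW2 (C : {set 'I_4}) : circuit MW2 C = (C \in W2_circuits).
Proof.
have antichain : {in W2_circuits &, forall A B : {set 'I_4}, A \subset B -> A = B}.
  move=> A B; rewrite !inE -!orbA => /or3P[] /eqP-> /or3P[] /eqP-> //;
  by rewrite !subUset !sub1set !inE.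
have depP (X : {set 'I_4}) : reflect (exists2 A, A \in W2_circuits & A \subset X)
    ((X \subset ground MW2) && (X \notin indep MW2)).
  rewrite subsetT inE negb_forall_in; apply: (iffP exists_inP).
    by case=> A AW; rewrite negbK; exists A.
  by case=> A AW AX; exists A; rewrite // negbK.
apply/minsetP/idP=> [[/depP[A AW AC] Cmin]|CW].
  by rewrite -(Cmin A) //; apply/depP; exists A.
split=> [|X /depP[A AW AX] XC]; first by apply/depP; exists C.
apply/eqP; rewrite eqEsubset XC.
by rewrite -(antichain A C AW CW (subset_trans AX XC)).
Qed.

(* Main.v *)
Require Import Defs.
From mathcomp Require Import all_boot.
From mathcomp Require Import zify.
Set Implicit Arguments.
Unset Strict Implicit.
Unset Printing Implicit Defensive.

(* A circuit of a minor M/C\D extends to a circuit of M, and minors of uniform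
   matroids are uniform; as M(W_2) is connected and non-uniform, one direction
   follows. For the converse let M be connected and non-uniform, and let e, f be
   distinct. Induct on |E(M)|: for g outside {e, f}, M\g or M/g is connected
   (Tutte), and since M(W_2) is self-dual we may assume that M\g is. If M\g is
   non-uniform, use the induction hypothesis. Otherwise M\g is uniform of the
   rank k of M, and g lies in the closure of some set I with |I| < k. If some
   such I does not contain both e and f, a minimal one yields an M(W_2)-minor
   with parallel pair {g, h}, h in I; if every such I contains both, contracting
   g and all but two elements of a hyperplane makes e and f parallel.
   The induction runs on rank functions, on which contraction and duality act
   by explicit formulas. *)

Lemma subset_card_between (T : finType) (A B : {set T}) (m : nat) :
  A \subset B -> #|A| <= m <= #|B| ->
  exists H : {set T}, [/\ A \subset H, H \subset B & #|H| = m].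
Proof.
have [n] := ubnP (m - #|A|); elim: n A => // n IHn A /ltnSE le_n AB /andP[Am mB].
have [E|ne] := eqVneq #|A| m; first by exists A.
have /set0Pn[x] : B :\: A != set0.
  by rewrite -card_gt0 cardsD (setIidPr AB); lia.
rewrite inE => /andP[xA xB].
have [|||H [AH HB Hm]] := IHn (x |: A).
- by rewrite cardsU1 xA; lia.
- by rewrite subUset sub1set xB.
- by rewrite cardsU1 xA; lia.
by exists H; split=> //; apply: subset_trans AH; apply: subsetUr.
Qed.

(* Generalizing the ranks keeps lia from comparing set expressions up to
   conversion. *)
Ltac rank_lia :=
  repeat match goal with
  | H : is_true (leq _ _) |- _ => revert H
  | H : @eq _ ?m ?n |- _ => change (@eq nat m n) in H; revert H
  end; clear;
  repeat match goal with
  | |- context [@card ?T ?A] => generalize (@card T A); intro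
  | |- context [?f ?X] =>
      match type of X with set_of _ =>
        match type of (f X) with nat => generalize (f X); intro end end
  end; lia.

(** * Rank functions, connectivity and duality *)

Section RankFunctions.
Variable T : finType.
Implicit Types (r : {set T} -> nat) (S X Y C W P I H : {set T}) (e f g : T).

Record rank_function r : Prop := RankFunction {
  rank_card : forall X, r X <= #|X|;
  rank_mono : forall X Y, X \subset Y -> r X <= r Y;
  rank_submod : forall X Y, r (X :|: Y) + r (X :&: Y) <= r X + r Y }.

Lemma rankU_card r X Y : rank_function r -> r (X :|: Y) <= r X + #|Y|.
Proof.
move=> rr; have := rank_submod rr X Y; have := rank_card rr Y; rank_lia.
Qed.

Lemma rankU1_le r x X : rank_function r -> r (x |: X) <= (r X).+1.
Proof. by move=> rr; rewrite setUC -addn1 -(cards1 x); apply: rankU_card. Qed.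

(** Submodularity for [X :|: I] and [Y], whose intersection contains [I]: whatever [I] spans, a
    larger set spans. *)
Lemma rank_closure r X I Y : rank_function r ->
  I \subset Y -> r (X :|: I) <= r I -> r (X :|: Y) <= r Y.
Proof.
move=> rr IY XI; have := rank_submod rr (X :|: I) Y.
rewrite -setUA (setUidPr IY).
have : r I <= r ((X :|: I) :&: Y) by apply: rank_mono; rewrite // subsetI subsetUr.
rank_lia.
Qed.

(** A maximal [I] of rank equal to its size spans each element of [X], and spanned elements can be
    added one at a time without raising the rank. *)
Lemma rank_basis r X : rank_function r ->
  exists I, [/\ I \subset X, r I = #|I| & r X = #|I|].
Proof.
move=> rr.
have P0 : (set0 \subset X) && (r set0 == #|@set0 T|).
  by rewrite sub0set; have := rank_card rr set0; rewrite cards0; rank_lia.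
have [I /maxsetP[/andP[IX /eqP rI] Imax] _] :=
  maxset_exists (P := fun I => (I \subset X) && (r I == #|I|)) P0.
exists I; split=> //; rewrite -rI; apply/eqP; rewrite eqn_leq (rank_mono rr IX) andbT.
suff H (Y : {set T}) : Y \subset X -> r (Y :|: I) <= r I.
  by have := H X (subxx _); rewrite (setUidPl IX).
have [n] := ubnP #|Y|; elim: n Y => // n IHn Y /ltnSE le_n YX.
have [->|[x xY]] := set_0Vmem Y; first by rewrite set0U.
have leD : r ((Y :\ x) :|: I) <= r I.
  apply: IHn; last exact: subset_trans (subsetDl _ _) YX.
  by move: le_n; rewrite (cardsD1 x) xY.
have xI : r (x |: I) <= r I.
  have [xI|xI] := boolP (x \in I); first by rewrite (setUidPr _) ?sub1set.
  rewrite leqNgt; apply/negP=> lt.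
  have rx : (x |: I \subset X) && (r (x |: I) == #|x |: I|).
    rewrite subUset IX sub1set (subsetP YX) //=.
    by have := rankU1_le x I rr; rewrite cardsU1 xI; rank_lia.
  by have := Imax _ rx (subsetUr _ _) => E; rewrite -E setU11 in xI.
have := @rank_closure r [set x] I ((Y :\ x) :|: I) rr (subsetUr _ _) xI.
by rewrite setUA setD1K //; rank_lia.
Qed.

Definition rank_connected S r : Prop :=
  forall X, X \subset S -> X != set0 -> X != S -> r S < r X + r (S :\: X).

(** The witness is both dependent and non-spanning. *)
Definition rank_nonuniform S r : bool :=
  [exists X : {set T}, [&& X \subset S, r X < #|X| & r X < r S]].

(* A minor isomorphic to M(W_2) has ground set W, is obtained by contracting C
   and deleting the rest, and its unique parallel pair is P. *)
Definition W2_minor S r e f : Prop := exists C W P,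
  [/\ W \subset S, C \subset S :\: W & #|W| = 4] /\
  [/\ e \in W, f \in W, P \subset W, #|P| = 2 & r (C :|: W) = r C + 2 /\
      forall X, X \subset W -> #|X| = 2 -> r (C :|: X) = r C + (X != P).+1].

Lemma W2_minorS S S' r e f : S \subset S' -> W2_minor S r e f -> W2_minor S' r e f.
Proof.
move=> SS' [C [W [P [[WS CS W4] H]]]]; exists C, W, P; split=> //; split=> //.
  exact: subset_trans SS'.
by apply: subset_trans CS _; apply: setSD.
Qed.

(** The usual corank formula; by [dual_rankE] the subtraction never truncates when [r] is a rank
    function. *)
Definition dual_rank S r X : nat := #|X| + r (S :\: X) - r S.

Lemma dual_rankE S r X : rank_function r ->
  dual_rank S r X + r S = #|X| + r (S :\: X).
Proof.
move=> rr; rewrite /dual_rank subnK //.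
apply: leq_trans (_ : r ((S :\: X) :|: X) <= _).
  by apply: rank_mono => //; rewrite setUC -subDset.
by rewrite addnC rankU_card.
Qed.

Lemma rank_function_dual S r : rank_function r -> rank_function (dual_rank S r).
Proof.
move=> rr; split=> [X|X Y XY|X Y].
- have := dual_rankE S X rr; have := rank_mono rr (subsetDl S X); rank_lia.
- have := dual_rankE S X rr; have := dual_rankE S Y rr.
  have := rankU_card (S :\: Y) (Y :\: X) rr.
  have : r (S :\: X) <= r ((S :\: Y) :|: (Y :\: X)).
    apply: rank_mono => //; apply/subsetP=> x; rewrite !inE.
    by case: (x \in X); case: (x \in Y); case: (x \in S).
  by have := subset_leq_card XY; rewrite cardsD (setIidPr XY); rank_lia.
- have := dual_rankE S X rr; have := dual_rankE S Y rr.
  have := dual_rankE S (X :&: Y) rr; have := dual_rankE S (X :|: Y) rr.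
  have := rank_submod rr (S :\: X) (S :\: Y); have := cardsUI X Y.
  by rewrite setDUr setDIr; rank_lia.
Qed.

(** The connectivity function r(X) + r(S - X) - r(S) is self-dual. *)
Lemma rank_connected_dual S r : rank_function r ->
  rank_connected S r -> rank_connected S (dual_rank S r).
Proof.
move=> rr co X XS X0 XnS; have := co X XS X0 XnS.
have := dual_rankE S X rr; have := dual_rankE S (S :\: X) rr.
have := dual_rankE S S rr; rewrite setDDr setDv set0U (setIidPr XS).
have := rank_card rr set0; have := subset_leq_card XS.
by rewrite cards0 cardsD (setIidPr XS); rank_lia.
Qed.

(** The complement of the witness works: complementation exchanges dependent sets with non-spanning
    sets of the dual. *)
Lemma rank_nonuniform_dual S r : rank_function r ->
  rank_nonuniform S r -> rank_nonuniform S (dual_rank S r).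
Proof.
move=> rr /existsP[X /and3P[XS lt1 lt2]]; apply/existsP; exists (S :\: X).
rewrite subsetDl /=.
have := dual_rankE S (S :\: X) rr.
have := dual_rankE S S rr; rewrite setDDr setDv set0U (setIidPr XS).
have := rank_card rr set0; have := subset_leq_card XS.
by rewrite cards0 cardsD (setIidPr XS); rank_lia.
Qed.

(** Duality swaps deletion and contraction, so the deleted set [C'] becomes the contracted one, and
    the complement of [P] in [W] becomes the parallel pair. *)
Lemma W2_minor_dual S r e f : rank_function r ->
  W2_minor S (dual_rank S r) e f -> W2_minor S r e f.
Proof.
move=> rr [C [W [P [[WS CS W4] [eW fW PW P2 [rW rX]]]]]].
pose C' := S :\: W :\: C.
have /andP[_ CW] : (C \subset S) && [disjoint C & W] by rewrite -subsetD.
have SC X : X \subset W -> S :\: (C :|: X) = C' :|: (W :\: X).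
  move=> XW; apply/setP=> x; rewrite !inE.
  move/implyP: (subsetP XW x); move/implyP: (subsetP WS x); move/implyP: (subsetP CS x).
  by rewrite !inE; case: (x \in X); case: (x \in C); case: (x \in W); case: (x \in S).
have cC X : X \subset W -> #|C :|: X| = #|C| + #|X|.
  by move=> XW; rewrite cardsU disjoint_setI0 ?cards0 ?subn0 //; apply: disjointWr CW.
have DW X : X \subset W -> W :\: (W :\: X) = X.
  by move=> XW; rewrite setDDr setDv set0U (setIidPr XW).
have E0 := dual_rankE S (C :|: set0) rr; rewrite SC ?cC ?sub0set // setD0 setU0 cards0 in E0.
have E4 := dual_rankE S (C :|: W) rr; rewrite SC ?cC ?subxx // setDv setU0 in E4.
exists C', W, (W :\: P); split; first by split=> //; apply: subsetDl.
split=> //; rewrite ?subsetDl //; first by rewrite cardsD (setIidPr PW); rank_lia.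
split=> [|X XW X2]; first rank_lia.
have X'2 : #|W :\: X| = 2 by rewrite cardsD (setIidPr XW); rank_lia.
have := dual_rankE S (C :|: (W :\: X)) rr; rewrite SC ?cC ?subsetDl // DW //.
rewrite rX ?subsetDl //.
have -> : (W :\: X != P) = (X != W :\: P).
  by congr (~~ _); apply/eqP/eqP=> [<-|->]; rewrite DW.
rank_lia.
Qed.

(** Tutte's theorem by uncrossing. The dual rank restricted to [S :\ g] is dual to the contraction
    of [g], so if both alternatives fail there are separations [A] of the deletion and [B] of the
    contraction. *)
Lemma rank_connected_delete_or_contract S r g : rank_function r -> g \in S ->
  rank_connected S r ->
  rank_connected (S :\ g) r \/ rank_connected (S :\ g) (dual_rank S r).
Proof.
move=> rr gS co.
pose bad r := [exists X : {set T}, [&& X \subset S :\ g, X != set0, X != S :\ g &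
  r X + r (S :\ g :\: X) <= r (S :\ g)]].
have badP r' : ~~ bad r' -> rank_connected (S :\ g) r'.
  move/existsPn=> H X XS X0 XnS; have := H X.
  by rewrite XS X0 XnS /= -ltnNge.
have [/existsP[A /and4P[AE A0 AnE lA]]|/badP] := boolP (bad r); last by left.
have [/existsP[B /and4P[BE B0 BnE lB]]|/badP] := boolP (bad (dual_rank S r)); last by right.
(* If both corners were nonempty, connectivity would bound the total rank of the corners and their
   complements below by 2 r(S) + 2, while submodularity bounds it above by r(S - g) + r(S) + 1. *)
have cross (X Y : {set T}) : X \subset S :\ g -> Y \subset S :\ g ->
    r X + r (S :\ g :\: X) <= r (S :\ g) ->
    r (g |: Y) + r (g |: (S :\ g :\: Y)) <= r S + 1 ->
    X :&: Y = set0 \/ (S :\ g :\: X) :&: (S :\ g :\: Y) = set0.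
  move=> XE YE lX lY.
  have [->|XY0] := eqVneq (X :&: Y) set0; first by left.
  have [->|XY'0] := eqVneq ((S :\ g :\: X) :&: (S :\ g :\: Y)) set0; first by right.
  have gX : g \notin X by apply/negP=> /(subsetP XE); rewrite !inE eqxx.
  have gY : g \notin Y by apply/negP=> /(subsetP YE); rewrite !inE eqxx.
  have c1 := co (X :&: Y).
  have c2 := co ((S :\ g :\: X) :&: (S :\ g :\: Y)).
  have s1 := rank_submod rr X (g |: Y).
  have s2 := rank_submod rr (S :\ g :\: X) (g |: (S :\ g :\: Y)).
  have e1 : X :&: (g |: Y) = X :&: Y.
    apply/setP=> x; rewrite !inE; case: eqP => // ->.
    by rewrite (negPf gX).
  have e2 : (S :\ g :\: X) :&: (g |: (S :\ g :\: Y)) =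
            (S :\ g :\: X) :&: (S :\ g :\: Y).
    by apply/setP=> x; rewrite !inE; case: eqP => //; rewrite ?andbF.
  have e3 : S :\: (X :&: Y) = (S :\ g :\: X) :|: (g |: (S :\ g :\: Y)).
    apply/setP=> x; rewrite !inE; case: eqP => [->|_] /=.
      by rewrite gS (negPf gX) ?orbT.
    by case: (x \in X); case: (x \in Y); case: (x \in S).
  have e4 : S :\: ((S :\ g :\: X) :&: (S :\ g :\: Y)) = X :|: (g |: Y).
    apply/setP=> x; rewrite !inE; case: eqP => [->|/eqP xg] /=.
      by rewrite gS !andbF orbT.
    move/implyP: (subsetP XE x); move/implyP: (subsetP YE x); rewrite !inE xg /=.
    by case: (x \in X); case: (x \in Y); case: (x \in S).
  have n1 : X :&: Y != S by apply/eqP=> /setP/(_ g); rewrite !inE gS (negPf gX).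
  have n2 : (S :\ g :\: X) :&: (S :\ g :\: Y) != S.
    by apply/eqP=> /setP/(_ g); rewrite !inE gS eqxx !andbF.
  have u1 : X :&: Y \subset S.
    apply: subset_trans (subsetIl _ _) _; apply: subset_trans XE _; exact: subsetDl.
  have u2 : (S :\ g :\: X) :&: (S :\ g :\: Y) \subset S.
    apply: subset_trans (subsetIl _ _) _; rewrite setDDl; exact: subsetDl.
  move: (c1 u1 XY0 n1) (c2 u2 XY'0 n2) s1 s2 (rank_mono rr (subsetDl S [set g])) lX lY.
  rewrite e1 e2 e3 e4; rank_lia.
(* The dual inequality for [B] in terms of [r]; the 1 bounds the rank of [[set g]]. *)
have lB' : r (g |: B) + r (g |: (S :\ g :\: B)) <= r S + 1.
  have := dual_rankE S B rr; have := dual_rankE S (S :\ g :\: B) rr.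
  have := dual_rankE S (S :\ g) rr.
  have -> : S :\: (S :\ g) = [set g].
    by apply/setP=> x; rewrite !inE; case: eqP => [->|]; rewrite ?gS //; case: (x \in S).
  have gB : g \notin B by apply/negP=> /(subsetP BE); rewrite !inE eqxx.
  have -> : S :\: (S :\ g :\: B) = g |: B.
    apply/setP=> x; rewrite !inE; case: eqP => [->|/eqP xg]; first by rewrite andbF gS.
    move/implyP: (subsetP BE x); rewrite !inE xg /=.
    by case: (x \in B); case: (x \in S).
  have -> : S :\: B = g |: (S :\ g :\: B).
    apply/setP=> x; rewrite !inE; case: eqP => [->|/eqP xg]; first by rewrite (negPf gB) gS.
    by [].
  have := subset_leq_card BE; have := rank_card rr [set g].
  by rewrite cards1 [#|_ :\: B|]cardsD (setIidPr BE); rank_lia.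
have DB : S :\ g :\: (S :\ g :\: B) = B by rewrite setDDr setDv set0U (setIidPr BE).
have empty (X Y Z : {set T}) : X \subset Z -> X :&: Y = set0 -> X :&: (Z :\: Y) = set0 -> X = set0.
  move=> XZ XY XZY; apply/setP=> x; move/setP/(_ x): XY; move/setP/(_ x): XZY.
  by have := subsetP XZ x; rewrite !inE; case: (x \in X) => // ->; case: (x \in Y).
have full (X Z : {set T}) : X \subset Z -> Z :\: X = set0 -> X = Z.
  by move=> XZ /eqP; rewrite setD_eq0 => ZX; apply/eqP; rewrite eqEsubset XZ.
(* Crossing [A] with [B] and with its complement empties two adjacent corners, hence a whole side of
   [A] or of [B]. *)
have [c1|c1] := cross A B AE BE lA lB'; have [] := cross A (S :\ g :\: B) AE (subsetDl _ _) lA _.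
- by rewrite DB addnC.
- by move=> c2; rewrite (empty A B (S :\ g)) ?eqxx in A0.
- rewrite DB => c2; case/negP: B0; apply/eqP/(empty B A (S :\ g)) => //; first by rewrite setIC.
  by rewrite setIC.
- by rewrite DB addnC.
- move=> c2; case/negP: BnE; apply/eqP/full => //.
  by apply: (empty _ A (S :\ g)); rewrite ?subsetDl // setIC.
- rewrite DB => c2; case/negP: AnE; apply/eqP/full => //.
  by apply: (empty _ B (S :\ g)); rewrite ?subsetDl.
Qed.

(** With the parallel pair named [p], [q], only the six pairs and an upper bound for all four
    elements remain to be checked; the lower bound comes from [[set p; u]]. *)
Lemma W2_minor_intro S r e f C p q u v : rank_function r ->
  uniq [:: p; q; u; v] -> [set p; q; u; v] \subset S :\: C -> C \subset S ->
  e \in [set p; q; u; v] -> f \in [set p; q; u; v] ->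
  r (C :|: [set p; q]) = r C + 1 -> r (C :|: [set p; u]) = r C + 2 ->
  r (C :|: [set p; v]) = r C + 2 -> r (C :|: [set q; u]) = r C + 2 ->
  r (C :|: [set q; v]) = r C + 2 -> r (C :|: [set u; v]) = r C + 2 ->
  r (C :|: [set p; q; u; v]) <= r C + 2 -> W2_minor S r e f.
Proof.
move=> rr uqs WSC CS eW fW Epq Epu Epv Equ Eqv Euv EW.
have W4 : #|[set p; q; u; v]| = 4.
  have -> : [set p; q; u; v] = [set x in [:: p; q; u; v]].
    by apply/setP=> x; rewrite !inE -!orbA.
  by rewrite cardsE; move/card_uniqP: uqs.
have npq : p != q by move: uqs; rewrite /= !inE; case: eqP.
exists C, [set p; q; u; v], [set p; q]; split; first split=> //.
- by apply: subset_trans WSC (subsetDl _ _).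
- by move: WSC; rewrite !subsetD disjoint_sym CS => /andP[].
split=> //; first by rewrite !subUset !sub1set !inE !eqxx ?orbT.
  by rewrite cards2 npq.
have mW : r (C :|: [set p; u]) <= r (C :|: [set p; q; u; v]).
  by apply: rank_mono => //; apply: setUS; rewrite subUset !sub1set !inE !eqxx ?orbT.
split=> [|X XW /eqP/cards2P[a [b [nab EX]]]]; first rank_lia.
have ne c d Y : r (C :|: [set c; d]) = r C + 2 -> [set c; d] = Y ->
    r (C :|: Y) = r C + (Y != [set p; q]).+1.
  move=> E <-; case: eqP => [E'|_]; last by rewrite E.
  by move: E; rewrite E' Epq; rank_lia.
have pq Y : [set p; q] = Y -> r (C :|: Y) = r C + (Y != [set p; q]).+1.
  by move=> <-; rewrite eqxx Epq.
have aW : a \in [set p; q; u; v] by apply: (subsetP XW); rewrite EX set21.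
have bW : b \in [set p; q; u; v] by apply: (subsetP XW); rewrite EX set22.
subst X; move: aW bW nab; rewrite !inE -!orbA.
by case/or4P=> /eqP-> /or4P[] /eqP->; rewrite ?eqxx // => _;
  first [ by apply: pq | by apply: pq; rewrite setUC
  | by apply: (ne _ _ _ Epu) => //; rewrite setUC | by apply: (ne _ _ _ Epv) => //; rewrite setUC
  | by apply: (ne _ _ _ Equ) => //; rewrite setUC | by apply: (ne _ _ _ Eqv) => //; rewrite setUC
  | by apply: (ne _ _ _ Euv) => //; rewrite setUC ].
Qed.

End RankFunctions.

(** * Connected single-element extensions of uniform matroids *)

Section UniformDeletion.
Variables (T : finType) (r : {set T} -> nat) (S : {set T}) (g : T) (k : nat).
Hypothesis rr : rank_function r.
Hypothesis gS : g \in S.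
Hypothesis r_small : forall X : {set T}, X \subset S :\ g -> #|X| <= k -> r X = #|X|.
Hypothesis r_large : forall X : {set T}, X \subset S :\ g -> k <= #|X| -> r X = k.
Hypothesis rS : r S = k.
Implicit Types X I H : {set T}.

(* The element g lies in the closure of the non-spanning set I. *)
Definition tight I := [&& I \subset S :\ g, #|I| < k & r (g |: I) <= #|I|].

(** Closure is monotone, so [H] spans [g]; and [H] is independent, having fewer than [k]
    elements. *)
Lemma tight_span I H :
  tight I -> I \subset H -> H \subset S :\ g -> #|H| < k -> r (g |: H) = #|H|.
Proof.
case/and3P=> IE Ik gI IH HE Hk.
have rI : r I = #|I| by apply: r_small => //; apply: ltnW.
have rH : r H = #|H| by apply: r_small => //; apply: ltnW.
have := rank_closure rr (X := [set g]) IH; rewrite rI rH => /(_ gI) le.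
by have := rank_mono rr (subsetUr [set g] H); rewrite rH; rank_lia.
Qed.

(** Since [I] spans [g] and [I :\ h] does not, exchange puts [h] in the closure of [g |: (I :\ h)].
    Adding [h] to the set in question then keeps its rank and yields a superset of the spanning set
    [x |: H]. *)
Lemma minimal_tight_exchange I H h x :
  tight I -> ~~ tight (I :\ h) -> I \subset H -> H \subset S :\ g ->
  #|H|.+1 = k -> h \in I -> x \in S :\ g :\: H -> r (g |: (x |: (H :\ h))) = k.
Proof.
move=> tI ntI IH HE Hk hI xEH.
have [IE Ik gI] := and3P tI.
have cI : #|I| = #|I :\ h|.+1 by rewrite (cardsD1 h) hI.
have lt : #|I :\ h| < r (g |: (I :\ h)).
  rewrite ltnNge; apply: contra ntI => le; rewrite /tight le andbT.
  by rewrite (subset_trans (subsetDl _ _) IE) /=; rank_lia.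
have le : r ([set h] :|: (g |: (I :\ h))) <= r (g |: (I :\ h)).
  by rewrite setUCA setD1K //; rank_lia.
have sub : g |: (I :\ h) \subset g |: (x |: (H :\ h)).
  by apply: setUS; apply: subset_trans (subsetUr _ _); apply: setSD.
have := rank_closure rr sub le.
have : k <= r ([set h] :|: (g |: (x |: (H :\ h)))).
  have hH : h \in H by apply: (subsetP IH).
  have -> : [set h] :|: (g |: (x |: (H :\ h))) = g |: (x |: H).
    by rewrite setUCA (setUCA [set h]) setD1K.
  case/setDP: xEH => xE xH; rewrite -(@r_large (x |: H)).
  - by apply: rank_mono; rewrite // subsetUr.
  - by rewrite subUset sub1set xE.
  - by rewrite cardsU1 xH; rank_lia.
have : r (g |: (x |: (H :\ h))) <= r S.
  apply: rank_mono => //; rewrite !subUset !sub1set gS.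
  case/setDP: xEH => /setD1P[_ ->] _.
  rewrite (subset_trans (subsetDl _ _)) // (subset_trans HE) //; exact: subsetDl.
rank_lia.
Qed.

Lemma W2_minor_one_in I H h x y e f :
  tight I -> (forall i, i \in I -> ~~ tight (I :\ i)) ->
  I \subset H -> H \subset S :\ g -> #|H|.+1 = k -> h \in I ->
  x \in S :\ g :\: H -> y \in S :\ g :\: H -> x != y ->
  e \in [set h; x; y] -> f \in [set h; x; y] -> W2_minor S r e f.
Proof.
move=> tI mI IH HE Hk hI xEH yEH nxy eW fW.
have hH : h \in H by apply: (subsetP IH).
have [xE xH] := setDP xEH; have [yE yH] := setDP yEH.
have [nxg xS] := setD1P xE; have [nyg yS] := setD1P yE.
have hE : h \in S :\ g by apply: (subsetP HE).
have [nhg hS] := setD1P hE.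
have nxh : x != h by apply: contraNneq xH => ->.
have nyh : y != h by apply: contraNneq yH => ->.
have gH : g \notin H by apply/negP=> /(subsetP HE); rewrite !inE eqxx.
have cH : #|H| = #|H :\ h|.+1 by rewrite (cardsD1 h) hH.
have HhE : H :\ h \subset S :\ g by apply: subset_trans (subsetDl _ _) HE.
have rC : r (H :\ h) = #|H :\ h| by apply: r_small => //; rank_lia.
have Eh : (H :\ h) :|: [set h; g] = g |: H by rewrite setUC [[set h; g]]setUC -setUA setD1K.
have E2 a b : (H :\ h) :|: [set a; b] = b |: (a |: (H :\ h)).
  by rewrite setUC [[set a; b]]setUC setUA.
have Ehx a : a \in S :\ g :\: H -> r ((H :\ h) :|: [set h; a]) = r (H :\ h) + 2.
  move=> aEH; have [aE aH] := setDP aEH.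
  rewrite E2 setD1K // r_large; first rank_lia.
    by rewrite subUset sub1set aE.
  by rewrite cardsU1 aH; rank_lia.
have Egx a : a \in S :\ g :\: H -> r ((H :\ h) :|: [set g; a]) = r (H :\ h) + 2.
  move=> aEH; have := minimal_tight_exchange tI (mI h hI) IH HE Hk hI aEH.
  by rewrite E2 setUCA; rank_lia.
apply: (@W2_minor_intro _ S r e f (H :\ h) h g x y) => //.
- by rewrite /= !inE !negb_or nhg [h == x]eq_sym nxh [h == y]eq_sym nyh
    [g == x]eq_sym nxg [g == y]eq_sym nyg nxy.
- by rewrite !subUset !sub1set !inE eqxx hS gS xS yS (negPf gH) (negPf xH) (negPf yH) !andbF.
- apply: subset_trans HhE _; exact: subsetDl.
- by move: eW; rewrite !inE => /orP[/orP[]|] ->; rewrite ?orbT.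
- by move: fW; rewrite !inE => /orP[/orP[]|] ->; rewrite ?orbT.
- by rewrite Eh (tight_span tI) //; rank_lia.
- exact: Ehx.
- exact: Ehx.
- exact: Egx.
- exact: Egx.
- rewrite E2 r_large; first rank_lia.
    by rewrite !subUset !sub1set yE xE.
  by rewrite !cardsU1 !inE eq_sym negb_or nxy (negPf xH) (negPf yH) !andbF /=; rank_lia.
- suff : r (H :\ h :|: [set h; g; x; y]) <= r S by rank_lia.
  apply: rank_mono => //; rewrite !subUset !sub1set hS gS xS yS !andbT.
  apply: subset_trans HhE _; exact: subsetDl.
Qed.

(* Here the parallel pair is {e, f}, obtained by contracting g. *)
Lemma W2_minor_both_in I H x y e f :
  (forall J : {set T}, tight J -> (e \in J) && (f \in J)) ->
  tight I -> I \subset H -> H \subset S :\ g -> #|H|.+1 = k -> e != f ->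
  x \in S :\ g :\: H -> y \in S :\ g :\: H -> x != y -> W2_minor S r e f.
Proof.
move=> all_ef tI IH HE Hk nef xEH yEH nxy.
have [eI fI] := andP (all_ef _ tI).
have eH : e \in H by apply: (subsetP IH).
have fH : f \in H by apply: (subsetP IH).
have [xE xH] := setDP xEH; have [yE yH] := setDP yEH.
have [nxg xS] := setD1P xE; have [nyg yS] := setD1P yE.
have [neg eS] := setD1P (subsetP HE _ eH); have [nfg fS] := setD1P (subsetP HE _ fH).
have gH : g \notin H by apply/negP=> /(subsetP HE); rewrite !inE eqxx.
have nxe : x != e by apply: contraNneq xH => ->.
have nye : y != e by apply: contraNneq yH => ->.
have nxf : x != f by apply: contraNneq xH => ->.
have nyf : y != f by apply: contraNneq yH => ->.
pose H' := H :\ e :\ f.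
have cH : #|H| = #|H'|.+2 by rewrite (cardsD1 e) eH (cardsD1 f) !inE eq_sym nef fH.
have H'E : H' \subset S :\ g by rewrite /H'; do 2 apply: subset_trans (subsetDl _ _) _.
(* A set avoiding [e] is not tight, so below size [k] it does not span [g]. *)
have nt (J : {set T}) : J \subset S :\ g -> e \notin J -> #|J| < k -> #|J| < r (g |: J).
  move=> JE eJ Jk; rewrite ltnNge; apply/negP=> le.
  have /all_ef : tight J by rewrite /tight JE Jk le.
  by rewrite (negPf eJ).
(* The failure of tightness that the exchange lemma needs, for [h] equal to [e] or [f]. *)
have nti i : i \in [set e; f] -> ~~ tight (I :\ i).
  move=> ief; apply/negP=> /all_ef; rewrite !inE.
  by case/set2P: ief => ->; rewrite eqxx ?andbF.
have rC : r (g |: H') = #|H'|.+1.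
  have eH' : e \notin H' by rewrite !inE eqxx andbF.
  have := nt _ H'E eH'; have := rankU1_le g H' rr; rewrite (r_small H'E); rank_lia.
have E2 a b : (g |: H') :|: [set a; b] = g |: (b |: (a |: H')).
  by rewrite -setUA (setUC H') [[set a; b]]setUC -setUA.
have Ee : e |: H' = H :\ f by rewrite /H' setDDl [[set e] :|: [set f]]setUC -setDDl setD1K // !inE nef.
have Ef : f |: H' = H :\ e by rewrite setD1K // !inE eq_sym nef.
have Eex a : a \in S :\ g :\: H -> r ((g |: H') :|: [set e; a]) = r (g |: H') + 2.
  move=> aEH; have := minimal_tight_exchange tI (nti f (set22 _ _)) IH HE Hk fI aEH.
  by rewrite E2 Ee rC; rank_lia.
have Efx a : a \in S :\ g :\: H -> r ((g |: H') :|: [set f; a]) = r (g |: H') + 2.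
  move=> aEH; have := minimal_tight_exchange tI (nti e (set21 _ _)) IH HE Hk eI aEH.
  by rewrite E2 Ef rC; rank_lia.
have H'S : H' \subset S by apply: subset_trans H'E (subsetDl _ _).
apply: (@W2_minor_intro _ S r e f (g |: H') e f x y) => //.
- by rewrite /= !inE !negb_or nef [e == x]eq_sym nxe [e == y]eq_sym nye
    [f == x]eq_sym nxf [f == y]eq_sym nyf nxy.
- by rewrite !subUset !sub1set !inE !eqxx !negb_or (negPf neg) (negPf nfg) (negPf nxg)
    (negPf nyg) eS fS xS yS (negPf xH) (negPf yH) !andbF.
- by rewrite subUset sub1set gS.
- by rewrite !inE eqxx.
- by rewrite !inE eqxx orbT.
(* The set is [g |: H], of rank [k - 1], one more than the contracted [g |: H']: this is the
   parallel pair. *)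
- rewrite E2 Ee setD1K // (tight_span tI) //; rank_lia.
- exact: Eex.
- exact: Eex.
- exact: Efx.
- exact: Efx.
(* With [x] and [y] added, [H'] has [k - 1] elements and still avoids [e], so adding [g] raises the
   rank to [k]. *)
- have JE : y |: (x |: H') \subset S :\ g by rewrite !subUset !sub1set yE xE.
  have cJ : #|y |: (x |: H')| = #|H'|.+2.
    by rewrite !cardsU1 !inE eq_sym negb_or nxy (negPf xH) (negPf yH) !andbF.
  have eJ : e \notin y |: (x |: H').
    by rewrite !inE !negb_or eqxx andbF [e == x]eq_sym nxe [e == y]eq_sym nye.
  have := nt _ JE eJ; have : r (g |: (y |: (x |: H'))) <= r S.
    apply: rank_mono => //; rewrite subUset sub1set gS.
    by apply: subset_trans JE (subsetDl _ _).
  by rewrite E2; rank_lia.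
- suff : r (g |: H' :|: [set e; f; x; y]) <= r S by rank_lia.
  by apply: rank_mono => //; rewrite !subUset !sub1set eS fS gS xS yS H'S.
Qed.

End UniformDeletion.

(** * The induction producing M(W_2)-minors *)

Section W2Minors.
Variable T : finType.
Implicit Types (r : {set T} -> nat) (S X B I H : {set T}) (e f g : T).

Lemma W2_minor_uniform_delete S r g e f : rank_function r -> g \in S ->
  rank_connected S r -> rank_connected (S :\ g) r ->
  rank_nonuniform S r -> ~~ rank_nonuniform (S :\ g) r ->
  e \in S :\ g -> f \in S :\ g -> e != f -> W2_minor S r e f.
Proof.
move=> rr gS coS coE nuS /existsPn uE eE fE nef.
have [neg eS] := setD1P eE; have [nfg fS] := setD1P fE.
set k := r (S :\ g).
have uE' X : X \subset S :\ g -> (#|X| <= r X) || (k <= r X).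
  by move=> XE; have := uE X; rewrite XE /= negb_and -!leqNgt.
have r_small X : X \subset S :\ g -> #|X| <= k -> r X = #|X|.
  move=> XE Xk; have := rank_card rr X.
  by case/orP: (uE' X XE); rank_lia.
have r_large X : X \subset S :\ g -> k <= #|X| -> r X = k.
  move=> XE Xk; have := rank_mono rr XE.
  by case/orP: (uE' X XE); rewrite -/k; rank_lia.
(* Connectivity applied to [[set g]]: [g] is neither a loop nor a coloop. *)
have [rS rg] : r S = k /\ r [set g] = 1.
  have nSg : [set g] != S by apply: contraNneq neg => E; rewrite -E inE in eS.
  have n0 : [set g] != set0 by apply/set0Pn; exists g; rewrite inE.
  have gsub : [set g] \subset S by rewrite sub1set.
  have := coS _ gsub n0 nSg; have := rank_mono rr (subsetDl S [set g]).
  have := rank_card rr [set g]; rewrite cards1 -/k; split; rank_lia.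
(* Connectivity of the deletion applied to [[set e]]. As a result, a set of [k - 1] elements misses
   at least two others. *)
have kE : k < #|S :\ g|.
  have nEe : [set e] != S :\ g.
    by apply: contraNneq nef => E; rewrite -E inE in fE; rewrite eq_sym.
  have n0 : [set e] != set0 by apply/set0Pn; exists e; rewrite inE.
  have esub : [set e] \subset S :\ g by rewrite sub1set.
  have := coE _ esub n0 nEe; have := rank_card rr (S :\ g :\: [set e]).
  have := rank_card rr [set e]; have := cardsD1 e (S :\ g).
  by rewrite cards1 eE /k; rank_lia.
(* A dependent non-spanning [X] contains [g] because the deletion is uniform; [X :\ g] is then
   independent, non-spanning, and spans [g]. *)
have [J tJ] : exists J, tight r S g k J.
  have /existsP[X /and3P[XS X1 X2]] := nuS; rewrite rS in X2.
  have gX : g \in X.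
    apply/negPn/negP=> gX; have := uE' X; rewrite subsetD1 XS gX => /(_ isT).
    by case/orP; rank_lia.
  have XE : X :\ g \subset S :\ g by apply: setSD.
  have cX := cardsD1 g X; rewrite gX in cX.
  have := rank_mono rr (subsetDl X [set g]).
  exists (X :\ g); rewrite /tight XE setD1K //=.
  by case/orP: (uE' _ XE); rank_lia.
have between I B : tight r S g k I -> I \subset B -> k <= #|B|.+1 ->
    exists H, [/\ I \subset H, H \subset B & #|H|.+1 = k].
  case/and3P=> _ Ik _ IB kB.
  have [|H [IH HB cH]] := @subset_card_between _ I B k.-1 IB; first by rank_lia.
  by exists H; rewrite IH HB cH; split=> //; rank_lia.
have cEH H : H \subset S :\ g -> #|H|.+1 = k -> 1 < #|S :\ g :\: H|.
  by move=> HE cH; rewrite cardsD (setIidPr HE); rank_lia.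
have [all_ef|/forallPn[J']] :=
    boolP [forall J : {set T}, tight r S g k J ==> (e \in J) && (f \in J)].
  have [||H [IH HE cH]] := between J (S :\ g) tJ; first by case/and3P: tJ.
    by rank_lia.
  have /card_gt1P[x [y [xEH yEH nxy]]] := cEH H HE cH.
  apply: (@W2_minor_both_in _ _ _ _ _ rr gS r_small r_large rS J H x y) => // J1.
  by move/forallP/(_ J1)/implyP: all_ef.
rewrite negb_imply => /andP[tJ' nef'].
have [I /minsetP[tI mI] IJ'] := minset_exists tJ'.
have nefI : ~~ ((e \in I) && (f \in I)).
  by apply: contra nef' => /andP[eI fI]; rewrite !(subsetP IJ').
have mI' i : i \in I -> ~~ tight r S g k (I :\ i).
  move=> iI; apply/negP=> t; have := mI _ t (subsetDl _ _) => E.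
  by rewrite -E !inE eqxx in iI.
have IE : I \subset S :\ g by case/and3P: tI.
(* Choosing [H] inside [B] keeps [e] and [f] out of [H] unless they lie in [I]. *)
pose B := I :|: (S :\ g :\ e :\ f).
have BE : B \subset S :\ g by rewrite subUset IE /=; do 2 apply: subset_trans (subsetDl _ _) _.
have cB : k <= #|B|.+1.
  have := subset_leq_card (subsetUr I (S :\ g :\ e :\ f)); rewrite -/B.
  have := cardsD1 e (S :\ g); have := cardsD1 f (S :\ g :\ e).
  by rewrite eE !inE; rank_lia.
have [H [IH HB cH]] := between I B tI (subsetUl _ _) cB.
have HE := subset_trans HB BE.
have outH x : x \in [set e; f] -> x \notin I -> x \notin H.
  move=> xef xI; apply/negP=> /(subsetP HB); rewrite !inE (negPf xI) /=.
  by case/set2P: xef => ->; rewrite eqxx ?andbF.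
have other x : x \in S :\ g :\: H -> exists2 y, y \in S :\ g :\: H & x != y.
  move=> xEH; have := cEH H HE cH; rewrite (cardsD1 x) xEH => /card_gt0P[y].
  by rewrite in_setD1 => /andP[nyx yEH]; exists y; rewrite // eq_sym.
have one_in h x y := @W2_minor_one_in _ _ _ _ _ rr gS r_small r_large rS I H h x y e f tI mI' IH HE cH.
(* If one of [e], [f] lies in [I], it takes the role of [h] and the other that of [x]. *)
have [eI|eI] := boolP (e \in I).
  have fI : f \notin I by move: nefI; rewrite eI.
  have fEH : f \in S :\ g :\: H by rewrite inE fE outH // set22.
  have [y yEH nfy] := other f fEH.
  by apply: (one_in e f y) => //; rewrite !inE eqxx ?orbT.
have eEH : e \in S :\ g :\: H by rewrite inE eE outH // set21.
have [fI|fI] := boolP (f \in I).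
  have [y yEH ney] := other e eEH.
  by apply: (one_in f e y) => //; rewrite !inE eqxx ?orbT.
have fEH : f \in S :\ g :\: H by rewrite inE fE outH // set22.
(* [I] is nonempty because [g] is not a loop, so some [h] in it is available. *)
have [I0|[h hI]] := set_0Vmem I.
  by case/and3P: tI => _ _; rewrite I0 setU0 rg cards0.
by apply: (one_in h e f) => //; rewrite !inE eqxx ?orbT.
Qed.

Lemma rank_connected_W2_minor S r e f : rank_function r ->
  rank_connected S r -> rank_nonuniform S r ->
  e \in S -> f \in S -> e != f -> W2_minor S r e f.
Proof.
have [n] := ubnP #|S|; elim: n S r => // n IHn S r /ltnSE le_n rr co nu eS fS nef.
(* A connected matroid on two elements is uniform: a witness [X] would be a single loop, hence a
   separation. *)
have [Sef|[g gS']] := set_0Vmem (S :\ e :\ f).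
  case/existsP: nu => X /and3P[XS X1 X2].
  have cS : #|S| = 2.
    by rewrite (cardsD1 e) eS (cardsD1 f) Sef cards0 !inE eq_sym nef fS.
  have X0 : X != set0 by rewrite -card_gt0; rank_lia.
  have XnS : X != S by apply: contraTneq X2 => ->; rewrite ltnn.
  have ltX : #|X| < #|S| by rewrite proper_card // properEneq XnS.
  have := co X XS X0 XnS; have := rank_mono rr (subsetDl S X).
  by rank_lia.
move: gS'; rewrite !inE => /and3P[ngf nge gS].
have eE : e \in S :\ g by rewrite !inE eq_sym nge.
have fE : f \in S :\ g by rewrite !inE eq_sym ngf.
(* Stated for an arbitrary rank function so that it also applies to the dual. *)
have step r' : rank_function r' -> rank_connected S r' -> rank_nonuniform S r' ->
    rank_connected (S :\ g) r' -> W2_minor S r' e f.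
  move=> rr' co' nu' coE.
  have [nuE|uE] := boolP (rank_nonuniform (S :\ g) r').
    apply: (W2_minorS (subsetDl S [set g])); apply: IHn => //.
    by move: le_n; rewrite (cardsD1 g) gS.
  exact: (W2_minor_uniform_delete rr' gS co' coE nu' uE).
have [coE|coE] := rank_connected_delete_or_contract rr gS co; first exact: step.
apply: W2_minor_dual => //; apply: step => //.
- exact: rank_function_dual.
- exact: rank_connected_dual.
- exact: rank_nonuniform_dual.
Qed.

End W2Minors.

(** * The rank function of a matroid and of its minors *)

Section MatroidRank.
Variable T : finType.
Implicit Types (M : matroid T) (X Y I C D : {set T}).

Definition rk M X : nat := \max_(I in indep M | I \subset X) #|I|.

Lemma indep_sub M I : I \in indep M -> I \subset ground M.
Proof. by have [sub _ _ _] := matroid_axiomP _ _ (matroidP M); apply: sub. Qed.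

Lemma indep_subset M I X : I \in indep M -> X \subset I -> X \in indep M.
Proof. by have [_ _ dn _] := matroid_axiomP _ _ (matroidP M); apply: dn. Qed.

Lemma indep_rk_ge M I X : I \in indep M -> I \subset X -> #|I| <= rk M X.
Proof. by move=> IM IX; apply: (bigmax_sup I); rewrite ?IM. Qed.

Lemma rk_witness M X : exists I, [/\ I \in indep M, I \subset X & #|I| = rk M X].
Proof.
have [_ M0 _ _] := matroid_axiomP _ _ (matroidP M).
have ne : 0 < #|[pred I : {set T} | (I \in indep M) && (I \subset X)]|.
  by apply/card_gt0P; exists set0; rewrite inE M0 sub0set.
have [I] := eq_bigmax_cond (fun I : {set T} => #|I|) ne.
by rewrite inE => /andP[IM IX] E; exists I; rewrite IM IX -E.
Qed.

(** For submodularity, a largest independent subset of [X :&: Y] is extended to a largest one, [J],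
    of [X :|: Y], and the elements of [J] in [X] and in [Y] are counted. *)
Lemma rank_function_rk M : rank_function (rk M).
Proof.
split=> [X|X Y XY|X Y].
- by have [I [_ IX <-]] := rk_witness M X; apply: subset_leq_card.
- by have [I [IM IX <-]] := rk_witness M X; apply: indep_rk_ge (subset_trans IX XY).
have [I [IM IXY cI]] := rk_witness M (X :&: Y).
have [B [BM BXY cB]] := rk_witness M (X :|: Y).
have [J [JM IJ JIB leBJ]] := augment_to IM BM.
have JXY : J \subset X :|: Y.
  apply: subset_trans JIB _; rewrite subUset BXY andbT.
  by apply: subset_trans IXY _; apply: subset_trans (subsetIl _ _) (subsetUl _ _).
have le1 : #|J :&: X| <= rk M X by apply: indep_rk_ge (subsetIr _ _); apply: indep_subset JM (subsetIl _ _).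
have le2 : #|J :&: Y| <= rk M Y by apply: indep_rk_ge (subsetIr _ _); apply: indep_subset JM (subsetIl _ _).
have le3 : #|I| <= #|(J :&: X) :&: (J :&: Y)|.
  by apply: subset_leq_card; rewrite -setIIr subsetI IJ.
have := cardsUI (J :&: X) (J :&: Y); rewrite -setIUr (setIidPl JXY).
rank_lia.
Qed.

Lemma indep_rkE M I : (I \in indep M) = (rk M I == #|I|).
Proof.
apply/idP/eqP=> [IM|rI].
  have := indep_rk_ge IM (subxx _); have := rank_card (rank_function_rk M) I; rank_lia.
have [J [JM JI cJ]] := rk_witness M I.
by have /eqP <- : J == I by rewrite eqEcard JI cJ rI leqnn.
Qed.

(** A rank function is determined by its independent sets, as each set contains an independent one
    of full rank. Ranks of duals and deletions are found this way. *)
Lemma rk_unique M (r : {set T} -> nat) X : rank_function r ->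
  (forall I, I \subset X -> (I \in indep M) = (r I == #|I|)) -> rk M X = r X.
Proof.
move=> rr rE; apply/eqP; rewrite eqn_leq; apply/andP; split.
  have [I [IM IX <-]] := rk_witness M X.
  by move: IM; rewrite rE // => /eqP <-; apply: rank_mono.
have [I [IX rI ->]] := rank_basis X rr.
by apply: (indep_rk_ge _ IX); rewrite rE // rI.
Qed.

(** A basis avoiding [I] gives its complement full rank; conversely, a largest independent subset of
    a complement of full rank is a basis. *)
Lemma indep_dualE M I : I \subset ground M ->
  (I \in indep (dual M)) = (rk M (ground M :\: I) == rk M (ground M)).
Proof.
have rr := rank_function_rk M.
move=> IE; rewrite inE; apply/exists_inP/eqP=> [[B bB IB]|rI].
  have [BM _] := maxsetP bB.
  have [J [JM _ cJ]] := rk_witness M (ground M).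
  have := basis_max bB JM.
  have BI : B \subset ground M :\: I.
    by rewrite subsetD indep_sub // disjoint_sym; move: IB; rewrite subsetD => /andP[].
  have := indep_rk_ge BM BI; have := rank_mono rr (subsetDl (ground M) I); rank_lia.
have [B [BM BI cB]] := rk_witness M (ground M :\: I).
exists B; last first.
  by rewrite subsetD IE disjoint_sym; move: BI; rewrite subsetD => /andP[].
apply/maxsetP; split=> // J JM BJ; apply/eqP; rewrite eq_sym eqEcard BJ cB rI.
exact: indep_rk_ge (indep_sub JM).
Qed.

Lemma rk_dual M X : X \subset ground M ->
  rk (dual M) X = dual_rank (ground M) (rk M) X.
Proof.
have rr := rank_function_rk M.
move=> XE; apply: rk_unique; first exact: rank_function_dual.
move=> I IX; rewrite indep_dualE; last exact: subset_trans XE.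
have := dual_rankE (ground M) I rr; have := rank_mono rr (subsetDl (ground M) I).
by move=> le E; apply/eqP/eqP; rank_lia.
Qed.

Lemma rk_delete M D X : X \subset ground M :\: D -> rk (delete M D) X = rk M X.
Proof.
move=> XE; apply: rk_unique; first exact: rank_function_rk.
move=> I IX; rewrite inE (subset_trans IX XE) andbT; exact: indep_rkE.
Qed.

(** Contraction is deletion in the dual, so the dual rank formula is applied twice; the additive
    form avoids subtraction. *)
Lemma rk_contract M C X : C \subset ground M -> X \subset ground M :\: C ->
  rk (contract M C) X + rk M C = rk M (C :|: X).
Proof.
move=> CE XE; rewrite /contract (@rk_dual (delete (dual M) C)) //.
have rr := rank_function_rk M.
have rr' := rank_function_rk (delete (dual M) C).
have := dual_rankE (ground (delete (dual M) C)) X rr'.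
rewrite [ground _]/= rk_delete //= rk_delete ?subsetDl //.
have EXE : ground M :\: C :\: X \subset ground M.
  by rewrite setDDl subsetDl.
rewrite !rk_dual ?subsetDl //.
have := dual_rankE (ground M) (ground M :\: C) rr.
have := dual_rankE (ground M) (ground M :\: C :\: X) rr.
have -> : ground M :\: (ground M :\: C) = C by rewrite setDDr setDv set0U (setIidPr CE).
have -> : ground M :\: (ground M :\: C :\: X) = C :|: X.
  rewrite setDDl setDDr setDv set0U (setIidPr _) // subUset CE.
  by apply: subset_trans XE (subsetDl _ _).
have := subset_leq_card XE.
by rewrite [#|_ :\: X|]cardsD (setIidPr XE); rank_lia.
Qed.

Lemma rk_minor M C D X : C \subset ground M -> X \subset ground M :\: C :\: D ->
  rk (delete (contract M C) D) X + rk M C = rk M (C :|: X).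
Proof.
move=> CE XE; rewrite rk_delete ?rk_contract //.
exact: subset_trans XE (subsetDl _ _).
Qed.

Lemma circuit_proper M X Y : circuit M X -> Y \proper X -> Y \in indep M.
Proof.
case/minsetP=> /andP[XE _] Xmin YX; apply/negPn/negP=> YM.
have YX' := proper_sub YX.
by move: YX; rewrite (Xmin Y) ?properxx // YM (subset_trans YX').
Qed.

(** A circuit [Z] meeting both [X] and its complement has independent parts there, so two uses of
    submodularity give r(E) + |Z| <= r(Z) + r(X) + r(E - X), where r(Z) < |Z|. *)
Lemma matroid_connected_rank M :
  matroid_connected M -> rank_connected (ground M) (rk M).
Proof.
have rr := rank_function_rk M.
move=> co X XE /set0Pn[e eX] XnE.
have /set0Pn[f] : ground M :\: X != set0.
  by apply: contraNneq XnE => /eqP; rewrite setD_eq0 => EX; rewrite eqEsubset XE.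
case/setDP=> fE fX.
have nef : e != f by apply: contraNneq fX => <-.
have [Z cZ] := co e f (subsetP XE _ eX) fE nef.
rewrite subUset !sub1set => /andP[eZ fZ].
have [/andP[ZE ZM] _] := minsetP cZ.
have r1 : rk M (Z :&: X) = #|Z :&: X|.
  apply/eqP; rewrite -indep_rkE; apply: circuit_proper cZ _.
  apply/properP; split; first exact: subsetIl.
  by exists f; rewrite // inE (negPf fX) andbF.
have r2 : rk M (Z :\: X) = #|Z :\: X|.
  apply/eqP; rewrite -indep_rkE; apply: circuit_proper cZ _.
  apply/properP; split; first exact: subsetDl.
  by exists e; rewrite // inE eX.
have s1 := rank_submod rr Z X; have s2 := rank_submod rr (Z :|: X) (ground M :\: X).
have e1 : (Z :|: X) :&: (ground M :\: X) = Z :\: X.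
  apply/setP=> x; move/implyP: (subsetP ZE x); rewrite !inE.
  by case: (x \in Z); case: (x \in X); case: (x \in ground M).
have e2 : ground M \subset (Z :|: X) :|: (ground M :\: X).
  by apply/subsetP=> x xE; rewrite !inE xE; case: (x \in X); rewrite !orbT.
have := rank_mono rr e2; have := cardsID X Z; have := rank_card rr Z.
have : rk M Z != #|Z| by rewrite -indep_rkE.
move: s1 s2; rewrite e1 => s1 s2 /eqP ne.
have {ne} lt : rk M Z <= #|Z| -> rk M Z < #|Z| by rewrite ltn_neqAle => ->; rewrite andbT; apply/eqP.
by move=> /lt {}lt; rank_lia.
Qed.

Lemma rank_uniform M : ~ uniform M -> rank_nonuniform (ground M) (rk M).
Proof.
have rr := rank_function_rk M.
move=> nu; have [//|/existsPn H] := boolP (rank_nonuniform _ _); case: nu.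
exists (rk M (ground M)); first exact: rank_card.
apply/setP=> I; rewrite inE indep_rkE.
have [IE|nIE] := boolP (I \subset ground M) => /=.
  have := H I; rewrite IE /= negb_and -!leqNgt => H'.
  have := rank_mono rr IE; have := rank_card rr I.
  by move=> ? ?; apply/eqP/idP=> ?; case/orP: H'; rank_lia.
apply/negbTE; apply: contra nIE; rewrite -indep_rkE; exact: indep_sub.
Qed.

End MatroidRank.

(** * Minors isomorphic to M(W_2) *)

Section MW2Minors.
Variable T : finType.
Implicit Types (M N : matroid T) (X Y Z W P C D : {set T}) (e f : T).

Lemma uniq4P (p q u v : T) : uniq [:: p; q; u; v] ->
  [/\ p != q, p != u & p != v] /\ [/\ q != u, q != v & u != v].
Proof. by rewrite /= !inE !negb_or -!andbA => /and4P[-> -> -> /and4P[-> -> ->]]. Qed.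

(** The right-hand side matches [W2_indepE], with [p], [q], [u], [v] in the roles of [W2a], [W2b],
    [W2c], [W2d]. *)
Lemma indep_W2E N p q u v Y : uniq [:: p; q; u; v] ->
  ground N = [set p; q; u; v] -> rk N (ground N) = 2 ->
  (forall X, X \subset ground N -> #|X| = 2 -> rk N X = (X != [set p; q]).+1) ->
  Y \subset ground N ->
  (Y \in indep N) = ~~ [|| (p \in Y) && (q \in Y),
                           [&& p \in Y, u \in Y & v \in Y]
                         | [&& q \in Y, u \in Y & v \in Y]].
Proof.
move=> /uniq4P[[npq npu npv] [nqu nqv nuv]] gN rN r2 YE.
have sub2 a b : a \in ground N -> b \in ground N -> [set a; b] \subset ground N.
  by move=> aE bE; rewrite subUset !sub1set aE.
have [pE qE uE vE] : [/\ p \in ground N, q \in ground N, u \in ground N & v \in ground N].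
  by rewrite gN !inE !eqxx ?orbT.
have dep3 a : a \in ground N -> a != u -> a != v ->
    [&& a \in Y, u \in Y & v \in Y] -> Y \notin indep N.
  move=> aE nau nav /and3P[aY uY vY]; apply/negP=> YN.
  have : [set a; u; v] \in indep N.
    by apply: indep_subset YN _; rewrite !subUset !sub1set aY uY.
  have : rk N [set a; u; v] <= rk N (ground N).
    by apply: (rank_mono (rank_function_rk N)); rewrite !subUset !sub1set aE uE.
  rewrite rN indep_rkE => le /eqP c; move: le.
  by rewrite c cardsU cards1 cards2 disjoint_setI0 ?cards0 ?nau //
    disjoint_sym disjoints1 !inE negb_or eq_sym nav eq_sym nuv.
have indY a b : a \in ground N -> b \in ground N -> a != b -> b != p -> b != q ->
    (forall x, x \in ground N -> x \in Y -> (x == a) || (x == b)) -> Y \in indep N.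
  move=> aE bE nab bp bq Yab; have : [set a; b] \in indep N.
    rewrite indep_rkE r2 ?sub2 ?cards2 ?nab //.
    suff -> : [set a; b] != [set p; q] by [].
    by apply/eqP=> /setP/(_ b); rewrite !inE eqxx orbT (negPf bp) (negPf bq).
  move/indep_subset; apply; apply/subsetP=> x xY; rewrite !inE; apply: Yab => //.
  exact: (subsetP YE).
have [nup nuq nvp nvq] : [/\ u != p, u != q, v != p & v != q].
  by rewrite ![u == _]eq_sym ![v == _]eq_sym.
have mem x : x \in ground N -> [|| x == p, x == q, x == u | x == v].
  by rewrite gN !inE -!orbA.
apply/idP/idP=> [YN|].
  rewrite !negb_or; apply/and3P; split.
  - apply/negP=> /andP[pY qY].
    have : [set p; q] \in indep N.
      by apply: indep_subset YN _; rewrite subUset !sub1set pY.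
    by rewrite indep_rkE r2 ?sub2 ?cards2 ?npq // eqxx.
  - by apply: contraL YN; apply: dep3.
  - by apply: contraL YN; apply: dep3.
(* Each membership pattern not excluded fits inside one of the five independent pairs. *)
case pY: (p \in Y); case qY: (q \in Y); case uY: (u \in Y); case vY: (v \in Y) => //= _.
all: let cover a b := (by apply: (indY a b) => // x /mem/or4P[] /eqP->;
       rewrite ?pY ?qY ?uY ?vY ?eqxx ?orbT) in
     first [cover p u | cover p v | cover q u | cover q v | cover u v].
Qed.

Lemma isomorphic_MW2 N P : #|ground N| = 4 -> P \subset ground N -> #|P| = 2 ->
  rk N (ground N) = 2 ->
  (forall X, X \subset ground N -> #|X| = 2 -> rk N X = (X != P).+1) ->
  isomorphic N MW2.
Proof.
move=> c4 PE P2 rN r2.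
have /eqP/cards2P[u [v [nuv EQ]]] : #|ground N :\: P| = 2.
  by rewrite cardsD (setIidPr PE) c4 P2.
have /eqP/cards2P[p [q [npq EP]]] := P2; subst P.
have gN : ground N = [set p; q; u; v].
  by rewrite -(setID (ground N) [set p; q]) (setIidPr PE) EQ setUA.
have uQ : u \in ground N :\: [set p; q] by rewrite EQ set21.
have vQ : v \in ground N :\: [set p; q] by rewrite EQ set22.
have uqs : uniq [:: p; q; u; v].
  move: uQ vQ; rewrite !inE !negb_or => /andP[/andP[up uq] _] /andP[/andP[vp vq] _].
  by rewrite /= !inE !negb_or npq [p == u]eq_sym up [p == v]eq_sym vp
    [q == u]eq_sym uq [q == v]eq_sym vq nuv.
have indepE := indep_W2E uqs gN rN r2.
(* The parallel pair goes to the rim, the other two elements to the spokes. *)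
pose F (x : {x : T | x \in ground N}) : 'I_4 :=
  if val x == p then W2a else if val x == q then W2b
  else if val x == u then W2c else W2d.
have memW y : y \in ground N -> [|| y == p, y == q, y == u | y == v].
  by rewrite gN !inE -!orbA.
have memN (x : {x : T | x \in ground N}) := memW _ (valP x).
have [[_ npu npv] [nqu nqv _]] := uniq4P uqs.
have FE x : [/\ (F x == W2a) = (val x == p), (F x == W2b) = (val x == q),
               (F x == W2c) = (val x == u) & (F x == W2d) = (val x == v)].
  have := memN x; rewrite /F.
  case/or4P=> /eqP->; rewrite ?eqxx ?(negPf npq) ?(negPf npu) ?(negPf npv)
   ?(negPf nqu) ?(negPf nqv) ?(negPf nuv) ?[q == p]eq_sym ?[u == p]eq_sym ?[v == p]eq_sym
   ?[u == q]eq_sym ?[v == q]eq_sym ?[v == u]eq_sym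
   ?(negPf npq) ?(negPf npu) ?(negPf npv) ?(negPf nqu) ?(negPf nqv) ?(negPf nuv) ?eqxx; by split.
have Finj : injective F.
  move=> x y Fxy; apply: val_inj; have [a1 b1 c1 d1] := FE x; have [a2 b2 c2 d2] := FE y.
  case/or4P: (memN x) => E; rewrite (eqP E); apply/esym/eqP.
  - by rewrite -a2 -Fxy a1.
  - by rewrite -b2 -Fxy b1.
  - by rewrite -c2 -Fxy c1.
  - by rewrite -d2 -Fxy d1.
exists F; split=> // [|X].
  by apply/eqP; rewrite eqEcard subsetT /= card_imset // !cardsT card_ord card_sig c4.
have memF (w : 'I_4) a : (forall x, (F x == w) = (val x == a)) ->
    (w \in F @: X) = (a \in val @: X).
  by move=> H; apply/imsetP/imsetP=> -[x xX E]; exists x => //; apply/esym/eqP;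
    [rewrite -H E | rewrite H E].
have XE : val @: X \subset ground N by apply/subsetP=> _ /imsetP[x _ ->]; apply: valP.
rewrite indepE // [RHS]W2_indepE (memF W2a p) ?(memF W2b q) ?(memF W2c u) ?(memF W2d v) //;
  by move=> x; have [] := FE x.
Qed.

Lemma W2_minor_MW2 M e f : W2_minor (ground M) (rk M) e f ->
  exists N, [/\ minor N M, isomorphic N MW2 & [set e; f] \subset ground N].
Proof.
case=> C [W [P [[WE CEW W4] [eW fW PW P2 [rW r2]]]]].
have /andP[CE dCW] : (C \subset ground M) && [disjoint C & W] by rewrite -subsetD.
have WEC : W \subset ground M :\: C by rewrite subsetD WE disjoint_sym.
have gW : ground M :\: C :\: (ground M :\: C :\: W) = W.
  by rewrite setDDr setDv set0U (setIidPr WEC).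
exists (delete (contract M C) (ground M :\: C :\: W)); split.
- exists C, (ground M :\: C :\: W); split=> //.
    by apply: subset_trans (subsetDl _ _) (subsetDl _ _).
  by rewrite -setI_eq0; apply/eqP/setP=> x; rewrite !inE; case: (x \in C); rewrite ?andbF.
- have rN X : X \subset W ->
      rk (delete (contract M C) (ground M :\: C :\: W)) X + rk M C = rk M (C :|: X).
    by move=> XW; apply: rk_minor; rewrite ?gW.
  apply: (@isomorphic_MW2 _ P); rewrite /= ?gW //.
    by have := rN W (subxx _); rank_lia.
  by move=> X XW X2; have := rN X XW; rewrite r2 //; rank_lia.
- by rewrite /= gW subUset !sub1set eW.
Qed.

(** For a largest independent subset [I] of [C], the set [I :|: Z] is dependent in [M] and so
    contains a circuit. A circuit missing some [z] in [Z] would lie in [I :|: (Z :\ z)], which is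
    independent. *)
Lemma minor_circuit_lift M C D Z : C \subset ground M ->
  Z \subset ground M :\: C :\: D -> Z \notin indep (delete (contract M C) D) ->
  (forall z, z \in Z -> Z :\ z \in indep (delete (contract M C) D)) ->
  exists2 K, circuit M K & Z \subset K.
Proof.
have rr := rank_function_rk M.
move=> CE ZE; rewrite indep_rkE => dZ iZ.
have [I [IM IC cI]] := rk_witness M C.
have rI : rk M I = #|I| by apply/eqP; rewrite -indep_rkE.
have ZCE : Z \subset ground M :\: C by apply: subset_trans ZE (subsetDl _ _).
have /andP[ZM dZC] : (Z \subset ground M) && [disjoint Z & C] by rewrite -subsetD.
have dIZ : [disjoint I & Z] by rewrite disjoint_sym; apply: disjointWr dZC.
have cIX X : X \subset Z -> #|I :|: X| = #|I| + #|X|.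
  by move=> XZ; rewrite cardsU disjoint_setI0 ?cards0 ?subn0 //; apply: disjointWr dIZ.
have rCX X : rk M (C :|: X) <= rk M (I :|: X).
  apply: leq_trans (rank_closure rr (subsetUl I X) (X := C) _).
    by apply: rank_mono => //; apply: setUS; apply: subsetUr.
  by rewrite (setUidPl IC) rI cI.
have depZ : (I :|: Z \subset ground M) && (I :|: Z \notin indep M).
  rewrite subUset (subset_trans IC CE) ZM /= indep_rkE cIX //.
  have : rk M (I :|: Z) <= rk M (C :|: Z) by apply: rank_mono => //; apply: setSU.
  rewrite -(rk_minor CE ZE) -cI; move: dZ (rank_card (rank_function_rk (delete (contract M C) D)) Z).
  by move=> /eqP; rank_lia.
have [K cK KIZ] := minset_exists (P := fun X : {set T} => (X \subset ground M) && (X \notin indep M)) depZ.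
exists K => //; apply/subsetP=> z zZ; apply/negPn/negP=> zK.
have [/andP[_ /negP nK] _] := minsetP cK; apply: nK.
have ZzE : Z :\ z \subset ground M :\: C :\: D by apply: subset_trans (subsetDl _ _) ZE.
suff IzM : I :|: (Z :\ z) \in indep M.
  apply: indep_subset IzM _; apply/subsetP=> x xK; have := subsetP KIZ x xK.
  by rewrite !inE; case: eqP => // xz; rewrite -xz xK in zK.
have := iZ z zZ; rewrite !indep_rkE cIX ?subsetDl // => /eqP rz.
have := rk_minor CE ZzE; rewrite rz -cI => E; have := rCX (Z :\ z).
have := rank_card rr (I :|: (Z :\ z)); rewrite cIX ?subsetDl // -E.
by move=> le1 le2; apply/eqP; rank_lia.
Qed.

(** Connectedness of M(W_2): its three circuits cover all pairs. *)
Lemma circuit_MW2_pair (a b : 'I_4) : a != b ->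
  exists2 A, circuit MW2 A & (a \in A) && (b \in A).
Proof.
move=> nab; have : [|| (a \in [set W2a; W2b]) && (b \in [set W2a; W2b]),
    (a \in [set W2a; W2c; W2d]) && (b \in [set W2a; W2c; W2d])
  | (a \in [set W2b; W2c; W2d]) && (b \in [set W2b; W2c; W2d])].
  by move: a b nab => [[|[|[|[|//]]]] ia] [[|[|[|[|//]]]] ib];
    rewrite !inE -!val_eqE.
case/or3P=> H; [exists [set W2a; W2b] | exists [set W2a; W2c; W2d]
  | exists [set W2b; W2c; W2d]] => //; by rewrite circuit_MW2 !inE eqxx ?orbT.
Qed.

End MW2Minors.

(** * Uniform matroids and the equivalence *)

Lemma imset_preimset_onto (T U : finType) (F : T -> U) (A : {set U}) :
  F @: [set: T] = [set: U] -> F @: (F @^-1: A) = A.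
Proof.
move=> FT; apply/setP=> w; apply/imsetP/idP=> [[x xA ->]|wA]; first by rewrite inE in xA.
have /imsetP[x _ wx] : w \in F @: [set: T] by rewrite FT inE.
by exists x; rewrite // inE -wx.
Qed.

Lemma rank_function_minn (T : finType) k : rank_function (fun X : {set T} => minn #|X| k).
Proof.
split=> [X|X Y /subset_leq_card|X Y]; [exact: geq_minl | rank_lia |].
have := subset_leq_card (subsetIl X Y); have := subset_leq_card (subsetIr X Y).
have := cardsUI X Y; rank_lia.
Qed.

Lemma rk_uniform (T : finType) (M : matroid T) k (X : {set T}) :
  indep M = [set I : {set T} | (I \subset ground M) && (#|I| <= k)] ->
  X \subset ground M -> rk M X = minn #|X| k.
Proof.
move=> iM XE; apply: (rk_unique (rank_function_minn T k)) => I IX.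
by rewrite iM inE (subset_trans IX XE) /=; apply/idP/eqP; rank_lia.
Qed.

Theorem theorem4p1 (T : finType) (M : matroid T) :
  N_connected MW2 M <-> matroid_connected M /\ ~ uniform M.
Proof.
split=> [[M2 HM]|[co nu]].
  split=> [e f eE fE nef|[k _ iM]].
    have [_ [[C [D [CE DE CD ->]]] [F [Finj Fim iF]] ef]] := HM e f eE fE nef.
    set N := delete _ D in F Finj Fim iF ef *.
    have [eN fN] : e \in ground N /\ f \in ground N.
      by apply/andP; move: ef; rewrite subUset !sub1set.
    pose e' : {x : T | x \in ground N} := Sub e eN.
    pose f' : {x : T | x \in ground N} := Sub f fN.
    have nef' : F e' != F f'.
      by apply: contraNneq nef => /Finj/(congr1 val) /= ->.
    (* A circuit through the images of [e] and [f] is pulled back to the minor [N] and then lifted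
       to [M]. *)
    have [A cA /andP[eA fA]] := circuit_MW2_pair nef'.
    have FA : F @: (F @^-1: A) = A by apply: imset_preimset_onto.
    have [/andP[_ dA] _] := minsetP cA.
    have [||z|K cK ZK] := @minor_circuit_lift _ M C D (val @: (F @^-1: A)) CE.
    - by apply/subsetP=> _ /imsetP[x _ ->]; apply: (valP x).
    - by rewrite -/N iF FA.
    - case/imsetP=> x xA ->; rewrite -/N.
      have -> : (val @: (F @^-1: A)) :\ val x = val @: ((F @^-1: A) :\ x).
        apply/setP=> y; rewrite in_setD1; apply/andP/imsetP=> [[nyx /imsetP[t tA yt]]|[t]].
          by exists t; rewrite // in_setD1 tA andbT; apply: contraNneq nyx => <-; rewrite yt.
        rewrite in_setD1 => /andP[ntx tA] ->; split; last exact: imset_f.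
        by apply: contraNneq ntx => /val_inj ->.
      rewrite iF; apply: circuit_proper cA _; apply/properP; split.
        by apply/subsetP=> _ /imsetP[t /setD1P[_ tA] ->]; rewrite inE in tA.
      exists (F x); first by rewrite inE in xA.
      by apply/imsetP=> -[t]; rewrite in_setD1 => /andP[ntx _] /Finj/eqP; rewrite eq_sym (negPf ntx).
    exists K => //; apply: subset_trans ZK; rewrite subUset !sub1set.
    by apply/andP; split; apply/imsetP; [exists e' | exists f']; rewrite ?inE.
  have /card_gt1P[e [f [eE fE nef]]] := M2.
  have [_ [[C [D [CE DE CD ->]]] [F [Finj Fim iF]] _]] := HM e f eE fE nef.
  set N := delete _ D in F Finj Fim iF.
  have pre (A : {set 'I_4}) : F @: (F @^-1: A) = A by apply: imset_preimset_onto.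
  have cF (A : {set 'I_4}) : #|val @: (F @^-1: A)| = #|A|.
    by rewrite card_imset; [rewrite -[in RHS](pre A) card_imset | apply: val_inj].
  (* Uniformity of [M] makes independence in M(W_2) depend only on the size of [A]. *)
  have rN (A : {set 'I_4}) : (A \in indep MW2) =
      (minn (#|C| + #|A|) k == #|A| + rk M C).
    have VE : val @: (F @^-1: A) \subset ground N.
      by apply/subsetP=> _ /imsetP[x _ ->]; apply: (valP x).
    have /andP[VM VC] : (val @: (F @^-1: A) \subset ground M) && [disjoint val @: (F @^-1: A) & C].
      by rewrite -subsetD; apply: subset_trans VE _; apply: subsetDl.
    rewrite -[in LHS](pre A) -iF indep_rkE cF -(eqn_add2r (rk M C)) rk_minor //.
    rewrite (rk_uniform iM); last by rewrite subUset CE.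
    by rewrite cardsU disjoint_setI0 ?cards0 ?subn0 ?cF // disjoint_sym.
  (* Two sets of equal size: the rim pair is dependent, the pair of spokes independent. *)
  have := rN [set W2a; W2b]; have := rN [set W2c; W2d].
  by rewrite !cards2 /= => <-; rewrite !W2_indepE !inE.
have nuM := rank_uniform nu.
split=> [|e f eE fE nef].
  (* With fewer than two elements, the dependent set [X] would be the whole ground set, which is
     spanning. *)
  have /existsP[X /and3P[XE X1 X2]] := nuM.
  rewrite ltnNge; apply/negP=> cE.
  have /eqP XE' : X == ground M by rewrite eqEcard XE; rank_lia.
  by rewrite XE' ltnn in X2.
apply: W2_minor_MW2; apply: rank_connected_W2_minor => //.
- exact: rank_function_rk.
- exact: matroid_connected_rank.
Qed.
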